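(* Let $M$ be a Malcev algebra over $\mathbb{F}$, $E$ a vector space which contains $M$ as a subspace, and $V$ a complement of $M$ in $E$. Let $\mathfrak{T}(M,V)$ be the set of all extending structures of $M$ through $V$. (1) Put $\mathcal{EH}^2(V,M):=\mathfrak{T}(M,V)/\equiv$. Then the map $$\mathcal{EH}^2(V,M)\to \mathrm{Extd}(E,M),\qquad \overline{\Omega(M,V)}\mapsto M\,\natural\,V$$ is bijective, where $\overline{\Omega(M,V)}$ is the equivalence class of $\Omega(M,V)$ under $\equiv$. (2) Put $\mathcal{UH}^2(V,M):=\mathfrak{T}(M,V)/\approx$. Then the map $$\mathcal{UH}^2(V,M)\to \mathrm{Extd}'(E,M),\qquad \overline{\overline{\Omega(M,V)}}\mapsto M\,\natural\,V$$ is bijective, where $\overline{\overline{\Omega(M,V)}}$ is the equivalence class of $\Omega(M,V)$ under $\approx$. Here $M\,\natural\,V$ stands for the class of the Malcev algebra structure on $E$ obtained by transporting the bracket of $M\,\natural\,V$ along the linear isomorphism $M\oplus V\to E$, $(x,u)\mapsto x+u$.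
   Context: All algebras and vector spaces are over an algebraically closed field $\mathbb{F}$ of characteristic different from $2$ and $3$. A Malcev algebra is a vector space $M$ with a bilinear operation $[\,,\,]:M\times M\to M$ such that $[x,y]=-[y,x]$ and $J(x,y,[x,z])=[J(x,y,z),x]$ for all $x,y,z\in M$, where $J(x,y,z)=[[x,y],z]+[[y,z],x]+[[z,x],y]$. An extending datum of a Malcev algebra $M$ through a vector space $V$ is a system $\Omega(M,V)=(\triangleleft,\triangleright,\omega,[\,,\,])$ consisting of two bilinear maps $\triangleright:M\times V\to V$ and $\triangleleft:M\times V\to M$ and two skew-symmetric bilinear maps $[\,,\,]:V\times V\to V$ and $\omega:V\times V\to M$. $M\,\natural\,V$ denotes the vector space $M\oplus V$ with the bracket $$[(x,u),(y,v)]=\big([x,y]+x\triangleleft v-y\triangleleft u+\omega(u,v),\ x\triangleright v-y\triangleright u+[u,v]\big).$$ The extending datum is called an extending structure, and $M\,\natural\,V$ the associated unified product, if this bracket makes $M\oplus V$ a Malcev algebra. Equivalence of structures on $E$: consider Malcev algebra structures on the vector space $E$ that contain $M$ (with its given bracket) as a subalgebra. Two such structures are equivalent if there is a Malcev algebra isomorphism $\varphi$ from $E$ with the first structure to $E$ with the second with $\varphi(x)=x$ for all $x\in M$ ($\varphi$ stabilizes $M$); they are cohomologous if moreover $\varphi$ can be chosen with $\pi\circ\varphi=\pi$, where $\pi:E=M\oplus V\to V$ is the canonical projection ($\varphi$ co-stabilizes $V$). $\mathrm{Extd}(E,M)$ is the set of equivalence classes and $\mathrm{Extd}'(E,M)$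 the set of cohomology classes of such structures. Equivalence of extending structures: $\Omega(M,V)=(\triangleleft,\triangleright,\omega,[\,,\,])$ and $\Omega'(M,V)=(\triangleleft',\triangleright',\omega',[\,,\,]')$ satisfy $\Omega\equiv\Omega'$ if there are linear maps $r:V\to M$ and $s:V\to V$ with $s$ bijective such that for all $x\in M$, $u,v\in V$: $x\triangleright' s(u)=s(x\triangleright u)$; $r(x\triangleright u)=[x,r(u)]-x\triangleleft u+x\triangleleft' s(u)$; $s([u,v])=[s(u),s(v)]'+r(u)\triangleright' s(v)-r(v)\triangleright' s(u)$; $r([u,v])=[r(u),r(v)]+r(u)\triangleleft' s(v)-r(v)\triangleleft' s(u)+\omega'(s(u),s(v))-\omega(u,v)$. They satisfy $\Omega\approx\Omega'$ if such a pair $(r,s)$ exists with $s=\mathrm{id}_V$. Both $\equiv$ and $\approx$ are equivalence relations on $\mathfrak{T}(M,V)$. *)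

(* Defs.v *)
From HB Require Import structures.
From mathcomp Require Import all_boot all_order all_algebra.
From mathcomp Require Import generic_quotient sesquilinear.
From mathcomp Require Import boolp.

Set Implicit Arguments.
Unset Strict Implicit.
Unset Printing Implicit Defensive.

Import GRing.Theory.
Local Open Scope ring_scope.
Local Open Scope quotient_scope.

Module ZmodSolver.

Inductive zexp := Var of nat | Zero | Opp of zexp | Add of zexp & zexp.

Fixpoint eval (V : zmodType) (env : seq V) (e : zexp) : V :=
  match e with
  | Var n => env`_n
  | Zero => 0
  | Opp e => - eval env e
  | Add e f => eval env e + eval env f
  end.

Fixpoint coef (e : zexp) (n : nat) : int :=
  match e with
  | Var m => (m == n)%:Z
  | Zero => 0
  | Opp e => - coef e n
  | Add e f => coef e n + coef f n
  end.

Fixpoint bounded (N : nat) (e : zexp) : bool :=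
  match e with
  | Var m => (m < N)%N
  | Zero => true
  | Opp e => bounded N e
  | Add e f => bounded N e && bounded N f
  end.

Lemma evalE (V : zmodType) (env : seq V) N e : bounded N e ->
  eval env e = \sum_(i < N) env`_i *~ coef e i.
Proof.
elim: e => [m lt_mN||e IHe|e IHe f IHf] /=.
- rewrite (bigD1 (Ordinal lt_mN)) //= eqxx big1 ?addr0 // => i neq_im.
  by case: eqP => // eq_mi; case/eqP: neq_im; apply: val_inj.
- by rewrite big1.
- by move=> /IHe ->; rewrite -sumrN; apply: eq_bigr => i _; rewrite mulrNz.
- case/andP=> /IHe -> /IHf ->; rewrite -big_split /=.
  by apply: eq_bigr => i _; rewrite mulrzDr.
Qed.

Lemma solve (V : zmodType) (env : seq V) e f :
  let N := size env in
  [&& bounded N e, bounded N f & all (fun i => coef e i == coef f i) (iota 0 N)] ->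
  eval env e = eval env f.
Proof.
move=> N /and3P[bd_e bd_f /allP eq_ef].
rewrite (evalE _ bd_e) (evalE _ bd_f); apply: eq_bigr => i _.
by rewrite (eqP (eq_ef _ _)) // mem_iota /=.
Qed.

(* Atoms are compared up to conversion: the same term may be typed through
   different structure instances. *)
Ltac lookup x env :=
  lazymatch env with
  | ?y :: ?env' =>
      match constr:(tt) with
      | _ => let _ := match constr:(tt) with _ => unify x y end in constr:(0%N)
      | _ => let n := lookup x env' in constr:(S n)
      end
  end.

Ltac atoms t env :=
  lazymatch t with
  | GRing.add ?a ?b => let env' := atoms a env in atoms b env'
  | GRing.opp ?a => atoms a env
  | GRing.zero => env
  | _ => match constr:(tt) with
         | _ => let _ := lookup t env in env
         | _ => constr:(t :: env)
         end
  end.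

Ltac reify t env :=
  lazymatch t with
  | GRing.add ?a ?b =>
      let a' := reify a env in let b' := reify b env in constr:(Add a' b')
  | GRing.opp ?a => let a' := reify a env in constr:(Opp a')
  | GRing.zero => constr:(Zero)
  | _ => let n := lookup t env in constr:(Var n)
  end.

Ltac zmod :=
  lazymatch goal with
  | |- @eq ?T ?L ?R =>
      let env := atoms L (@nil T) in
      let env := atoms R env in
      let e := reify L env in
      let f := reify R env in
      exact: (@solve _ env e f)
  end.

End ZmodSolver.

Ltac zmod := ZmodSolver.zmod.

Section ClassicalQuotient.
Context (T : Type) (R : T -> T -> Prop).
Context (R_refl : forall x, R x x) (R_sym : forall x y, R x y -> R y x)
  (R_trans : forall x y z, R x y -> R y z -> R x z).

Definition class_rel (x y : {classic T}) : bool := `[< R x y >].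

Lemma class_rel_equiv : equiv_class_of class_rel.
Proof.
split=> [x|x y|y x z]; first exact/asboolP.
  by apply/asboolP/asboolP => /R_sym.
by move=> /asboolP xy /asboolP yz; apply/asboolP/(R_trans xy).
Qed.

Definition class_equiv : equiv_rel {classic T} := EquivRelPack class_rel_equiv.

End ClassicalQuotient.

Section MalcevAlgebras.
Context (F : fieldType) (L : lmodType F).

Definition jacobian (b : L -> L -> L) (x y z : L) : L :=
  b (b x y) z + b (b y z) x + b (b z x) y.

Definition is_malcev (b : L -> L -> L) : Prop :=
  (forall x y, b x y = - b y x) /\
  (forall x y z, jacobian b x y (b x z) = b (jacobian b x y z) x).

Record malcev := Malcev {
  malcev_bracket :> {bilinear L -> L -> L};
  malcevP : is_malcev malcev_bracket
}.

Lemma malcevC (b : malcev) x y : b x y = - b y x.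
Proof. by case: (malcevP b). Qed.

End MalcevAlgebras.

Section ExtendingStructures.
Context (F : fieldType) (M V : lmodType F).

(* [act_l] is the map written with a left-pointing triangle (valued in M),
   [act_r] the one written with a right-pointing triangle (valued in V). *)
Record extending_datum := ExtendingDatum {
  act_l : {bilinear M -> V -> M};
  act_r : {bilinear M -> V -> V};
  cocycle : {bilinear V -> V -> M};
  vbracket : {bilinear V -> V -> V};
  cocycle_skew : forall u v, cocycle u v = - cocycle v u;
  vbracket_skew : forall u v, vbracket u v = - vbracket v u
}.

Context (mu : malcev M).

Definition unified_bracket (O : extending_datum) (p q : M * V) : M * V :=
  (mu p.1 q.1 + act_l O p.1 q.2 - act_l O q.1 p.2 + cocycle O p.2 q.2,
   act_r O p.1 q.2 - act_r O q.1 p.2 + vbracket O p.2 q.2).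

Record extending_structure := ExtendingStructure {
  ext_datum :> extending_datum;
  unified_malcev : is_malcev (unified_bracket ext_datum)
}.

Lemma unified_bracket_bilinear (O : extending_datum) :
  bilinear_for *:%R *:%R (unified_bracket O).
Proof.
by split=> [[y v]|[y v]] c [x u] [x' u']; congr pair;
  rewrite /= ?linearPl ?linearPr /= ?scalerDr ?scalerN; zmod.
Qed.

HB.instance Definition _ (O : extending_datum) :=
  bilinear_isBilinear.Build F (M * V)%type (M * V)%type (M * V)%type _ _ (unified_bracket O)
    (unified_bracket_bilinear O).

Definition unified_product (O : extending_structure) : malcev (M * V)%type :=
  @Malcev F (M * V)%type (unified_bracket O) (unified_malcev O).

Definition equiv_by (O O' : extending_structure) (r : V -> M) (s : V -> V) :=
  [/\ forall x u, act_r O' x (s u) = s (act_r O x u),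
      forall x u, r (act_r O x u) = mu x (r u) - act_l O x u + act_l O' x (s u),
      forall u v, s (vbracket O u v) =
        vbracket O' (s u) (s v) + act_r O' (r u) (s v) - act_r O' (r v) (s u)
    & forall u v, r (vbracket O u v) =
        mu (r u) (r v) + act_l O' (r u) (s v) - act_l O' (r v) (s u)
        + cocycle O' (s u) (s v) - cocycle O u v].

Definition ext_equiv (O O' : extending_structure) : Prop :=
  exists (r : {linear V -> M}) (s : {linear V -> V}),
    bijective s /\ equiv_by O O' r s.

Definition ext_cohom (O O' : extending_structure) : Prop :=
  exists r : {linear V -> M}, equiv_by O O' r id.

Lemma equiv_by_refl O : equiv_by O O \0 id.
Proof.
split=> [//|x u|u v|u v] /=; rewrite ?linear0r ?linear0l; zmod.
Qed.

Lemma equiv_by_sym O O' (r : {linear V -> M}) (s t : {linear V -> V}) :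
  cancel s t -> cancel t s -> equiv_by O O' r s -> equiv_by O' O (\- (r \o t)) t.
Proof.
move=> sK tK [e1 e2 e3 e4].
have e1' x a : act_r O x (t a) = t (act_r O' x a).
  by apply: (can_inj sK); rewrite -e1 !tK.
have e3' a b : t (vbracket O' a b) = vbracket O (t a) (t b)
    - act_r O (r (t a)) (t b) + act_r O (r (t b)) (t a).
  apply: (can_inj sK); rewrite tK !linearD linearN /= e3 -!e1 !tK; zmod.
split=> [//|x a|a b|a b] /=.
- by rewrite -e1' e2 tK linearN /=; zmod.
- by rewrite e3' !linearNl /=; zmod.
- rewrite e3' !linearD linearN /= e4 !e2 !tK !linearNl !linearNr /=.
  by rewrite (malcevC _ (r (t b))); zmod.
Qed.

Lemma equiv_by_trans O O' O'' (r r' : {linear V -> M}) (s s' : {linear V -> V}) :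
  equiv_by O O' r s -> equiv_by O' O'' r' s' ->
  equiv_by O O'' (r \+ (r' \o s)) (s' \o s).
Proof.
move=> [e1 e2 e3 e4] [f1 f2 f3 f4].
split=> [x u|x u|u v|u v] /=.
- by rewrite f1 e1.
- by rewrite e2 -e1 f2 !linearDr /=; zmod.
- by rewrite e3 !linearD linearN /= -!f1 f3 !linearDl /=; zmod.
- rewrite e4 e3 !linearD linearN /= f4 !f2 !linearDl /= ?linearDr /=.
  by rewrite (malcevC _ (r v)); zmod.
Qed.

Lemma ext_equiv_refl O : ext_equiv O O.
Proof. by exists \0, idfun; split; [exists id | apply: equiv_by_refl]. Qed.

Lemma ext_equiv_sym O O' : ext_equiv O O' -> ext_equiv O' O.
Proof.
move=> [r [s [[t sK tK] rsP]]].
have t_lin : linear t.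
  by move=> c u v; apply: (can_inj sK); rewrite linearP !tK.
pose tL : {linear V -> V} := HB.pack t (GRing.isLinear.Build F V V _ t t_lin).
exists (\- (r \o tL)), tL; split; first by exists s.
exact: (@equiv_by_sym O O' r s tL).
Qed.

Lemma ext_equiv_trans O O' O'' :
  ext_equiv O O' -> ext_equiv O' O'' -> ext_equiv O O''.
Proof.
move=> [r [s [bij_s rsP]]] [r' [s' [bij_s' rsP']]].
exists (r \+ (r' \o s)), (s' \o s); split; first exact: bij_comp.
exact: equiv_by_trans rsP'.
Qed.

Lemma ext_cohom_refl O : ext_cohom O O.
Proof. by exists \0; apply: equiv_by_refl. Qed.

Lemma ext_cohom_sym O O' : ext_cohom O O' -> ext_cohom O' O.
Proof.
move=> [r rP]; exists (\- (r \o idfun)).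
exact: (@equiv_by_sym O O' r idfun idfun).
Qed.

Lemma ext_cohom_trans O O' O'' :
  ext_cohom O O' -> ext_cohom O' O'' -> ext_cohom O O''.
Proof.
move=> [r rP] [r' rP']; exists (r \+ (r' \o idfun)).
exact: (@equiv_by_trans O O' O'' r r' idfun idfun).
Qed.

Definition EH2 : Type :=
  {eq_quot (class_equiv ext_equiv_refl ext_equiv_sym ext_equiv_trans)}.
HB.instance Definition _ := EqQuotient.on EH2.

Definition UH2 : Type :=
  {eq_quot (class_equiv ext_cohom_refl ext_cohom_sym ext_cohom_trans)}.
HB.instance Definition _ := EqQuotient.on UH2.

End ExtendingStructures.

Arguments EH2 {F M} V mu.
Arguments UH2 {F M} V mu.

Section Extensions.
Context (F : fieldType) (E : lmodType F) (SM SV : pred E).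
Context (M : subLmodType SM) (V : subLmodType SV).

Definition complement : Prop :=
  (forall (x : M) (u : V), \val x = \val u :> E -> \val x = 0 :> E) /\
  (forall e : E, exists p : M * V, e = \val p.1 + \val p.2).

Record malcev_extension (mu : malcev M) := MalcevExtension {
  ext_bracket :> malcev E;
  ext_sub : forall x y : M, ext_bracket (\val x) (\val y) = \val (mu x y)
}.

Context (mu : malcev M) (hV : complement).

Lemma decomp_ex (e : E) : exists p : M * V, e == \val p.1 + \val p.2.
Proof. by have [p ->] := hV.2 e; exists p. Qed.

Definition decomp (e : E) : M * V := xchoose (decomp_ex e).
Definition complement_proj (e : E) : V := (decomp e).2.
Definition recomp (p : M * V) : E := \val p.1 + \val p.2.

Lemma decompK : cancel decomp recomp.
Proof. by move=> e; exact: esym (eqP (xchooseP (decomp_ex e))). Qed.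

Lemma recomp_linear : linear recomp.
Proof. by move=> c p q; rewrite /recomp /= !linearP /= scalerDr; zmod. Qed.

HB.instance Definition _ := GRing.isLinear.Build F (M * V)%type E _ recomp recomp_linear.

Lemma recompK : cancel recomp decomp.
Proof.
suff recomp_inj : injective recomp by move=> p; apply: recomp_inj; apply: decompK.
apply: raddf_inj => -[x u] /= xu0.
have x0 : \val x = 0 :> E.
  apply: (hV.1 x (- u)); rewrite linearN /=.
  by apply/eqP; rewrite -subr_eq0 opprK; apply/eqP.
have u0 : \val u = 0 :> E by rewrite -xu0 /recomp /= x0 add0r.
by congr pair; apply: val_inj; rewrite /= linear0.
Qed.

Lemma decomp_linear : linear decomp.
Proof. by move=> c e f; apply: (can_inj recompK); rewrite linearP /= !decompK. Qed.

HB.instance Definition _ := GRing.isLinear.Build F E (M * V)%type _ decomp decomp_linear.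

Definition transported_bracket (b : malcev (M * V)%type) (e f : E) : E :=
  recomp (b (decomp e) (decomp f)).

Lemma transported_bracket_bilinear b :
  bilinear_for *:%R *:%R (transported_bracket b).
Proof.
by split=> [f|e] c x y; rewrite /transported_bracket linearP ?linearPl ?linearPr linearP.
Qed.

HB.instance Definition _ b :=
  bilinear_isBilinear.Build F E E E _ _ (transported_bracket b)
    (transported_bracket_bilinear b).

Lemma transported_bracket_malcev b : is_malcev (transported_bracket b).
Proof.
have [bC bJ] := malcevP b.
have tbE e f : decomp (transported_bracket b e f) = b (decomp e) (decomp f).
  by rewrite /transported_bracket recompK.
have tbJ x y z : decomp (jacobian (transported_bracket b) x y z) =
    jacobian b (decomp x) (decomp y) (decomp z).
  by rewrite /jacobian 2!(linearD decomp) /= !tbE.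
split=> [x y|x y z]; apply: (can_inj decompK).
  by rewrite linearN /= !tbE bC.
by rewrite tbE !tbJ tbE bJ.
Qed.

(* The Malcev structure of the unified product, carried to E along
   (x, u) |-> x + u. *)
Definition transported_product (O : extending_structure V mu) : malcev E :=
  Malcev (transported_bracket_malcev (unified_product O)).

Lemma transported_product_sub O (x y : M) :
  transported_product O (\val x) (\val y) = \val (mu x y).
Proof.
have decomp_val (z : M) : decomp (\val z) = (z, 0).
  by apply: (can_inj recompK); rewrite decompK /recomp /= linear0 addr0.
rewrite /transported_product /= /transported_bracket !decomp_val.
by rewrite /recomp /= /unified_bracket /= !(linear0r, linear0l, subr0, addr0, linear0).
Qed.

Definition transported_extension (O : extending_structure V mu) :
    malcev_extension mu :=
  MalcevExtension (transported_product_sub O).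

Definition stabilizing_iso (A B : malcev_extension mu) (phi : {linear E -> E}) :=
  [/\ bijective phi,
      forall e f, phi (A e f) = B (phi e) (phi f)
    & forall x : M, phi (\val x) = \val x].

Definition extension_equiv (A B : malcev_extension mu) : Prop :=
  exists phi, stabilizing_iso A B phi.

Definition extension_cohom (A B : malcev_extension mu) : Prop :=
  exists phi, stabilizing_iso A B phi /\
    forall e, complement_proj (phi e) = complement_proj e.

Lemma stabilizing_iso_refl A : stabilizing_iso A A idfun.
Proof. by split=> //; exists id. Qed.

Lemma stabilizing_iso_sym A B phi : stabilizing_iso A B phi ->
  exists2 psi, stabilizing_iso B A psi & cancel psi phi.
Proof.
move=> [[t phiK tK] phiM phi_val].
have t_lin : linear t.
  by move=> c u v; apply: (can_inj phiK); rewrite linearP !tK.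
pose psi : {linear E -> E} := HB.pack t (GRing.isLinear.Build F E E _ t t_lin).
exists psi => //; split=> [|e f|x]; first by exists phi.
  by apply: (can_inj phiK); rewrite phiM !tK.
by apply: (can_inj phiK); rewrite tK phi_val.
Qed.

Lemma stabilizing_iso_trans A B C phi psi :
  stabilizing_iso A B phi -> stabilizing_iso B C psi ->
  stabilizing_iso A C (psi \o phi).
Proof.
move=> [bij_phi phiM phi_val] [bij_psi psiM psi_val].
split=> [|e f|x] /=; first exact: bij_comp.
  by rewrite phiM psiM.
by rewrite phi_val psi_val.
Qed.

Lemma extension_equiv_refl A : extension_equiv A A.
Proof. by exists idfun; apply: stabilizing_iso_refl. Qed.

Lemma extension_equiv_sym A B : extension_equiv A B -> extension_equiv B A.
Proof. by move=> [phi /stabilizing_iso_sym[psi]]; exists psi. Qed.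

Lemma extension_equiv_trans A B C :
  extension_equiv A B -> extension_equiv B C -> extension_equiv A C.
Proof.
move=> [phi phiP] [psi psiP]; exists (psi \o phi).
exact: stabilizing_iso_trans phiP psiP.
Qed.

Lemma extension_cohom_refl A : extension_cohom A A.
Proof. by exists idfun; split=> //; apply: stabilizing_iso_refl. Qed.

Lemma extension_cohom_sym A B : extension_cohom A B -> extension_cohom B A.
Proof.
move=> [phi [/stabilizing_iso_sym[psi psiP psiK] phi_pr]].
by exists psi; split=> // e; rewrite -phi_pr psiK.
Qed.

Lemma extension_cohom_trans A B C :
  extension_cohom A B -> extension_cohom B C -> extension_cohom A C.
Proof.
move=> [phi [phiP phi_pr]] [psi [psiP psi_pr]]; exists (psi \o phi).
by split=> [|e]; [apply: stabilizing_iso_trans phiP psiP | rewrite /= psi_pr].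
Qed.

Definition Extd : Type :=
  {eq_quot (class_equiv extension_equiv_refl extension_equiv_sym
              extension_equiv_trans)}.
HB.instance Definition _ := EqQuotient.on Extd.

Definition Extd' : Type :=
  {eq_quot (class_equiv extension_cohom_refl extension_cohom_sym
              extension_cohom_trans)}.
HB.instance Definition _ := EqQuotient.on Extd'.

End Extensions.

(* Main.v *)
(* A linear endomorphism of M (+) V fixing M pointwise has the form
   (x, u) |-> (x + r u, s u); it is bijective iff s is, and it covers the
   identity of V iff s = id. Being a morphism between two unified products,
   tested on the pairs (x, u) and (u, v), is exactly the compatibility system
   for (r, s). Conversely, every bracket on E extending that of M is itself a
   unified product, with the components of the brackets [x, u] and [u, v] along
   M and V as its extending datum. *)

Require Import Defs.
From mathcomp Require Import all_boot all_order all_algebra.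
From mathcomp Require Import generic_quotient sesquilinear.
From HB Require Import structures.
From mathcomp Require Import boolp.

Set Implicit Arguments.
Unset Strict Implicit.
Unset Printing Implicit Defensive.

Import GRing.Theory.
Local Open Scope ring_scope.
Local Open Scope quotient_scope.

(** Preserving the relation makes [g] descend to the quotients, reflecting it makes the induced map
    injective, and hitting every [S]-class makes it surjective. *)
Lemma class_quot_bijection (T U : Type) (R : T -> T -> Prop) (S : U -> U -> Prop)
    (Rr : forall x, R x x) (Rs : forall x y, R x y -> R y x)
    (Rt : forall x y z, R x y -> R y z -> R x z)
    (Sr : forall x, S x x) (Ss : forall x y, S x y -> S y x)
    (St : forall x y z, S x y -> S y z -> S x z) (g : T -> U) :
  (forall x y, R x y <-> S (g x) (g y)) -> (forall y, exists x, S (g x) y) ->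
  exists f : {eq_quot (class_equiv Rr Rs Rt)} -> {eq_quot (class_equiv Sr Ss St)},
    (forall x : T, f (\pi_({eq_quot (class_equiv Rr Rs Rt)}) x)
                 = \pi_({eq_quot (class_equiv Sr Ss St)}) (g x)) /\
    bijective f.
Proof.
move=> RS g_surj.
set QT := {eq_quot _}; set QU := {eq_quot (class_equiv Sr Ss St)}.
have piT (x y : T) : R x y <-> \pi_QT x = \pi_QT y.
  by split=> [xy|/eqmodP/asboolP //]; apply/eqmodP/asboolP.
have piU (x y : U) : S x y <-> \pi_QU x = \pi_QU y.
  by split=> [xy|/eqmodP/asboolP //]; apply/eqmodP/asboolP.
(* [h] chooses a preimage up to [S]; it induces the inverse of [f]. *)
have [h hP] := choice g_surj.
pose f (q : QT) : QU := \pi_QU (g (repr q)).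
have fE (x : T) : f (\pi_QT x) = \pi_QU (g x).
  by apply/piU/RS/piT; rewrite reprK.
exists f; split=> //; exists (fun q : QU => \pi_QT (h (repr q))) => q.
  (* Reflection along [g] reduces the goal to [U], where [g (h y)] is related to [y] for
     [y := repr (f q)]. *)
  rewrite -[RHS]reprK; apply/piT/RS/(St _ _ _ (hP _))/piU.
  by rewrite reprK.
by rewrite fE -[RHS]reprK; apply/piU.
Qed.

(** * Block triangular maps between unified products *)

Section UnifiedProductMorphisms.
Context (F : fieldType) (M V : lmodType F) (mu : malcev M).
Implicit Types O : extending_structure V mu.

Definition shear (r : V -> M) (s : V -> V) (p : M * V) : M * V :=
  (p.1 + r p.2, s p.2).

Lemma shear_linear (r : {linear V -> M}) (s : {linear V -> V}) :
  linear (shear r s).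
Proof.
by move=> c p q; congr pair; rewrite /= !linearP //= scalerDr; zmod.
Qed.

Lemma shear_bijective (r : {linear V -> M}) (s : {linear V -> V}) :
  bijective (shear r s) <-> bijective s.
Proof.
split=> [[g gK Kg]|[t sK tK]]; last first.
  exists (fun p => (p.1 - r (t p.2), t p.2)) => -[x u].
    by rewrite /shear /= sK addrK.
  by rewrite /shear /= tK subrK.
(* The inverse of [s] is the V-component of [g] on V; the M-component of a preimage of [(0, s u)] is
   [- r u]. *)
exists (fun u => (g (0, u)).2) => u.
  suff -> : (0, s u) = shear r s (- r u, u) by rewrite gK.
  by rewrite /shear /= addNr.
by have /(congr1 snd) := Kg (0, u).
Qed.

Lemma shear_morphismP O O' (r : {linear V -> M}) (s : {linear V -> V}) :
  (forall p q, shear r s (unified_bracket mu O p q)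
     = unified_bracket mu O' (shear r s p) (shear r s q)) <->
  equiv_by O O' r s.
Proof.
split=> [shearM|[e1 e2 e3 e4] [x u] [y v]].
  (* Each test pair yields two equations: the V- and M-components of [mixed] are the first two
     compatibility conditions, those of [pureV] the last two. *)
  have mixed x u := shearM (x, 0) (0, u).
  have pureV u v := shearM (0, u) (0, v).
  rewrite /shear /unified_bracket /= in mixed pureV.
  split=> [x u|x u|u v|u v].
  - have [_] := mixed x u.
    by rewrite !(linear0, linear0l, linear0r, add0r, addr0, subr0) => ->.
  - have [+ _] := mixed x u.
    rewrite !(linear0, linear0l, linear0r, add0r, addr0, subr0) => e.
    by apply: (addrI (act_l O x u)); rewrite e; zmod.
  - have [_] := pureV u v.
    by rewrite !(linear0, linear0l, linear0r, add0r, addr0, subr0) => ->; zmod.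
  - have [+ _] := pureV u v.
    rewrite !(linear0, linear0l, linear0r, add0r, addr0, subr0) => e.
    by apply: (addrI (cocycle O u v)); rewrite e; zmod.
rewrite /shear /unified_bracket /=; congr pair.
  rewrite !linearD !linearN /= e4 !e2 !linearDl ?linearDr /=.
  (* The second condition, applied to [y] and [u], produces [mu y (r u)], so the opposite order must
     be flipped. *)
  by rewrite (malcevC mu (r u) y); zmod.
by rewrite !linearD !linearN /= e3 -!e1 !linearDl /=; zmod.
Qed.

End UnifiedProductMorphisms.

(** * Extensions of M on E compared with unified products *)

Section ExtensionsAsUnifiedProducts.
Context (F : fieldType) (E : lmodType F) (SM SV : pred E).
Context (M : subLmodType SM) (V : subLmodType SV) (mu : malcev M).
Context (hV : complement M V).
Implicit Types O : extending_structure V mu.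

Lemma decomp_valM (x : M) : decomp hV (\val x) = (x, 0).
Proof. by apply: (can_inj (recompK hV)); rewrite decompK /recomp /= linear0 addr0. Qed.

(** Conjugation by [decomp] turns [phi] into the shear and the transported brackets into the unified
    ones. Such a [phi] fixes M since [r] and [s] vanish at 0. *)
Lemma stabilizing_isoP O O' (phi : {linear E -> E})
    (r : {linear V -> M}) (s : {linear V -> V}) :
  (forall e, phi e = recomp (shear r s (decomp hV e))) ->
  stabilizing_iso (transported_extension hV O) (transported_extension hV O') phi
  <-> bijective s /\ equiv_by O O' r s.
Proof.
move=> phiE.
have bij_phi : bijective phi <-> bijective s.
  rewrite -(shear_bijective r s).
  have bijD : bijective (decomp hV).
    by exists (@recomp _ _ _ _ M V); [apply: decompK | apply: recompK].
  have bijR : bijective (@recomp _ _ _ _ M V).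
    by exists (decomp hV); [apply: recompK | apply: decompK].
  split=> bij.
    apply: (@eq_bij _ _ (decomp hV \o phi \o @recomp _ _ _ _ M V)).
      by do 2!apply: bij_comp => //.
    by move=> p; rewrite /= phiE !recompK.
  apply: (@eq_bij _ _ (@recomp _ _ _ _ M V \o shear r s \o decomp hV)).
    by do 2!apply: bij_comp => //.
  by move=> e; rewrite /= phiE.
have bracketE (Q : extending_structure V mu) e f :
    transported_extension hV Q e f
    = recomp (unified_bracket mu Q (decomp hV e) (decomp hV f)) by [].
split=> [[/bij_phi bij_s phiM _]|[/bij_phi bij_phi' /shear_morphismP rsM]].
  split=> //; apply/shear_morphismP => p q.
  have := phiM (recomp p) (recomp q).
  by rewrite !bracketE !phiE !recompK => /(can_inj (recompK hV)).
split=> // [e f|x]; first by rewrite !bracketE !phiE !recompK rsM.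
by rewrite phiE decomp_valM /shear /= !linear0 addr0 /recomp /= linear0 addr0.
Qed.

(** Since [phi] is linear and fixes M, it is determined by its restriction to V, whose M- and
    V-components are [r] and [s]. *)
Lemma stabilizing_shear (phi : {linear E -> E}) :
  (forall x : M, phi (\val x) = \val x) ->
  exists (r : {linear V -> M}) (s : {linear V -> V}),
    forall e, phi e = recomp (shear r s (decomp hV e)).
Proof.
move=> phi_val.
pose psi (u : V) := decomp hV (phi (\val u)).
have psi_lin : linear psi by move=> c u v; rewrite /psi !linearP.
have r_lin : linear (fst \o psi) by move=> c u v; rewrite /= psi_lin.
have s_lin : linear (snd \o psi) by move=> c u v; rewrite /= psi_lin.
pose r : {linear V -> M} := HB.pack (fst \o psi) (GRing.isLinear.Build F V M _ _ r_lin).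
pose s : {linear V -> V} := HB.pack (snd \o psi) (GRing.isLinear.Build F V V _ _ s_lin).
exists r, s => e; rewrite -{1}(decompK hV e); case: (decomp hV e) => x u.
rewrite /recomp linearD /= phi_val -(decompK hV (phi (\val u))).
by rewrite /recomp /shear /= linearD addrA.
Qed.

Lemma shear_extension (r : {linear V -> M}) (s : {linear V -> V}) :
  exists phi : {linear E -> E}, forall e, phi e = recomp (shear r s (decomp hV e)).
Proof.
pose f e := recomp (shear r s (decomp hV e)).
have f_lin : linear f.
  by move=> c e e'; rewrite /f linearP shear_linear linearP.
pose phi : {linear E -> E} := HB.pack f (GRing.isLinear.Build F E E _ f f_lin).
by exists phi.
Qed.

Lemma ext_equivP O O' :
  ext_equiv O O' <->
  extension_equiv (transported_extension hV O) (transported_extension hV O').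
Proof.
split=> [[r [s rsP]]|[phi phiP]].
  have [phi phiE] := shear_extension r s.
  by exists phi; apply/(stabilizing_isoP _ _ phiE).
have [_ _ /stabilizing_shear[r [s phiE]]] := phiP.
by exists r, s; apply/(stabilizing_isoP _ _ phiE).
Qed.

Lemma ext_cohomP O O' :
  ext_cohom O O' <->
  extension_cohom hV (transported_extension hV O) (transported_extension hV O').
Proof.
split=> [[r rP]|[phi [phiP phi_pr]]].
  have [phi phiE] := shear_extension r idfun.
  exists phi; split; last by move=> e; rewrite /complement_proj phiE recompK.
  by apply/(stabilizing_isoP _ _ phiE); split=> //; exists id.
have [_ _ /stabilizing_shear[r [s phiE]]] := phiP.
(* Preserving the projection forces [s] to fix the V-component of every [e], so the identity may
   replace [s] in the formula for [phi]. *)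
exists r; have phiE' e : phi e = recomp (shear r idfun (decomp hV e)).
  rewrite phiE; congr recomp; congr pair.
  by have := phi_pr e; rewrite /complement_proj phiE recompK.
by have [] := (stabilizing_isoP _ _ phiE').1 phiP.
Qed.

(** The bracket of [A] is pulled back to the direct sum and split into blocks. Agreement is stated
    pointwise, which suffices for the identity of E to be an isomorphism. *)
Lemma transported_extension_surj (A : malcev_extension mu) :
  exists O, forall e f, transported_extension hV O e f = A e f.
Proof.
have [AC AJ] := malcevP A.
pose b (p q : M * V) := decomp hV (A (recomp p) (recomp q)).
pose bMV (x : M) (u : V) := decomp hV (A (\val x) (\val u)).
pose bVV (u v : V) := decomp hV (A (\val u) (\val v)).
have bMV_bil : bilinear_for *:%R *:%R bMV.
  by split=> [u|x] c y z; rewrite /bMV linearP ?linearPl ?linearPr linearP.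
have bVV_bil : bilinear_for *:%R *:%R bVV.
  by split=> [u|x] c y z; rewrite /bVV linearP ?linearPl ?linearPr linearP.
have bVVC u v : bVV u v = - bVV v u by rewrite /bVV AC linearN.
have [bMVl bMVr] := bMV_bil; have [bVVl bVVr] := bVV_bil.
have al_bil : bilinear_for *:%R *:%R (fun x u => (bMV x u).1).
  by split=> [u|x] c y z; rewrite /= (bMVl, bMVr).
have ar_bil : bilinear_for *:%R *:%R (fun x u => (bMV x u).2).
  by split=> [u|x] c y z; rewrite /= (bMVl, bMVr).
have co_bil : bilinear_for *:%R *:%R (fun u v => (bVV u v).1).
  by split=> [u|x] c y z; rewrite /= (bVVl, bVVr).
have br_bil : bilinear_for *:%R *:%R (fun u v => (bVV u v).2).
  by split=> [u|x] c y z; rewrite /= (bVVl, bVVr).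
pose al : {bilinear M -> V -> M} :=
  HB.pack (fun x u => (bMV x u).1) (bilinear_isBilinear.Build F M V M _ _ _ al_bil).
pose ar : {bilinear M -> V -> V} :=
  HB.pack (fun x u => (bMV x u).2) (bilinear_isBilinear.Build F M V V _ _ _ ar_bil).
pose co : {bilinear V -> V -> M} :=
  HB.pack (fun u v => (bVV u v).1) (bilinear_isBilinear.Build F V V M _ _ _ co_bil).
pose br : {bilinear V -> V -> V} :=
  HB.pack (fun u v => (bVV u v).2) (bilinear_isBilinear.Build F V V V _ _ _ br_bil).
have coC u v : co u v = - co v u by rewrite /= bVVC.
have brC u v : br u v = - br v u by rewrite /= bVVC.
pose D := @ExtendingDatum F M V al ar co br coC brC.
(* Expanding [b] gives four blocks: [ext_sub] handles M with M, and skew-symmetry turns V with M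
   into minus M with V. *)
have DE p q : unified_bracket mu D p q = b p q.
  case: p q => [x u] [y v]; rewrite /b /recomp /= !linearDl ?linearDr /=.
  rewrite ext_sub (AC (\val u) (\val y)) !linearD linearN /= decomp_valM.
  rewrite -/(bMV x v) -/(bMV y u) -/(bVV u v) /unified_bracket /= /al /ar /co /br /=.
  by case: (bMV x v) (bMV y u) (bVV u v) => [? ?] [? ?] [? ?]; congr pair => /=; zmod.
have UE p q : recomp (unified_bracket mu D p q) = A (recomp p) (recomp q).
  by rewrite DE decompK.
have UJ p q t : recomp (jacobian (unified_bracket mu D) p q t) =
    jacobian A (recomp p) (recomp q) (recomp t).
  by rewrite /jacobian 2!(linearD (@recomp _ _ _ _ M V)) /= !UE.
(* The Malcev identities of [A] pull back along the injective linear map [recomp]. *)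
have DP : is_malcev (unified_bracket mu D).
  split=> [p q|p q t]; apply: (can_inj (recompK hV)).
    by rewrite linearN /= !UE AC.
  by rewrite UJ !UE UJ AJ.
exists (ExtendingStructure DP) => e f.
by rewrite /= /transported_bracket /= UE !decompK.
Qed.

Lemma eq_stabilizing_iso (A B : malcev_extension mu) :
  (forall e f, A e f = B e f) -> stabilizing_iso A B idfun.
Proof. by move=> AB; split=> //; exists id. Qed.

End ExtensionsAsUnifiedProducts.

Theorem theorem2p5 (F : closedFieldType)
    (char2 : (2 \notin [pchar F])%N) (char3 : (3 \notin [pchar F])%N)
    (E : lmodType F) (SM SV : pred E)
    (M : subLmodType SM) (V : subLmodType SV) (mu : malcev M)
    (hV : complement M V) :
  (exists f : EH2 V mu -> Extd mu,
     (forall O : extending_structure V mu,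
        f (\pi_(EH2 V mu) O) = \pi_(Extd mu) (transported_extension hV O)) /\
     bijective f) /\
  (exists f : UH2 V mu -> Extd' mu hV,
     (forall O : extending_structure V mu,
        f (\pi_(UH2 V mu) O) = \pi_(Extd' mu hV) (transported_extension hV O)) /\
     bijective f).
Proof.
(* Both parts use the same map on structures. The identity of E also preserves the projection, so it
   witnesses surjectivity for both relations. *)
split; apply: class_quot_bijection => [O O'|A].
- exact: ext_equivP.
- have [O OA] := transported_extension_surj hV A.
  by exists O, idfun; apply: eq_stabilizing_iso.
- exact: ext_cohomP.
- have [O OA] := transported_extension_surj hV A.
  by exists O, idfun; split=> //; apply: eq_stabilizing_iso.
Qed.
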